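(* For every positive integer $k$ and every $n$, every $4$-uniform hypergraph on $n$ vertices containing no Berge copy of the path $P_k$ with $k$ edges has strong chromatic number at most $k+11$; that is, $\mathrm{schex}_4(n,\mathcal{B}(P_k))\le k+11$.
   Context: For a graph $F$, a hypergraph $\mathcal{H}$ is a Berge-$F$ if there is a bijection $f:E(F)\to E(\mathcal{H})$ with $e\subseteq f(e)$ for every $e\in E(F)$; $\mathcal{B}(F)$ is the family of Berge-$F$ hypergraphs. A hypergraph contains a Berge copy of $F$ if it has a subhypergraph in $\mathcal{B}(F)$. $\mathrm{schex}_4(n,\mathcal{B}(F))$ is the supremum of the strong chromatic number (minimum number of colors in a vertex coloring in which each hyperedge is rainbow) over $\mathcal{B}(F)$-free $4$-uniform hypergraphs on $n$ vertices. *)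

(* Defs.v *)
From mathcomp Require Import all_boot.
Set Implicit Arguments.
Unset Strict Implicit.
Unset Printing Implicit Defensive.

(* A hypergraph on the vertex set [T] is given by its set of hyperedges; a
   graph is a 2-uniform hypergraph. *)
Notation hypergraph T := {set {set T}}.

Section Hypergraphs.
Variable T : finType.
Implicit Type H : hypergraph T.

Definition uniform (r : nat) H : bool := [forall e in H, #|e| == r].

Definition strong_coloring (q : nat) H (c : {ffun T -> 'I_q}) : bool :=
  [forall e in H, dinjectiveb c (mem e)].

Definition strong_colorable H (q : nat) : bool :=
  [exists c : {ffun T -> 'I_q}, strong_coloring H c].

Lemma strong_colorable_ex H : exists q, strong_colorable H q.
Proof.
exists #|T|; apply/existsP; exists [ffun x => enum_rank x].
apply/forall_inP=> e _; apply/dinjectiveP=> x y _ _.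
by rewrite !ffunE; apply: enum_rank_inj.
Qed.

Definition strong_chromatic_number H : nat := ex_minn (strong_colorable_ex H).

Variable V : finType.
Implicit Type F : hypergraph V.

(* [phi] realises the vertices of F as vertices of the hypergraph, so that the
   inclusion of an edge of F in a hyperedge makes sense; [f] restricts to a
   bijection from the edges of F onto the hyperedges of H. *)
Definition is_berge F H : bool :=
  [exists phi : {ffun V -> T}, exists f : {ffun {set V} -> {set T}},
    [&& injectiveb phi, dinjectiveb f (mem F), f @: F == H
      & [forall e in F, phi @: e \subset f e]]].

Definition has_berge_copy F H : bool :=
  [exists H' : hypergraph T, (H' \subset H) && is_berge F H'].

Definition berge_free F H : bool := ~~ has_berge_copy F H.

End Hypergraphs.

(* The maximum ranges over a finite set; it is nonempty as soon as F has an
   edge. *)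
Definition schex (r n : nat) (V : finType) (F : hypergraph V) : nat :=
  \max_(H : hypergraph 'I_n | uniform r H && berge_free F H)
     strong_chromatic_number H.

(* The path with k edges {i, i+1}, i < k, on the k+1 vertices 0, ..., k. *)
Definition path_graph (k : nat) : hypergraph 'I_k.+1 :=
  [set [set widen_ord (leqnSn k) i; lift ord0 i] | i : 'I_k].

(* Main.v *)
Require Import Defs.
From mathcomp Require Import all_boot.
From mathcomp Require Import zify.

(** The argument works for hyperedges with at most [r] vertices, [r >= 2], and
    gives the bound [k + N - 1], where [N = degree_excess r = (r - 1) c] and [c]
    is the integer part of [r ^ 2 / 4]; for [r = 4] this is [k + 11].

    If the strong chromatic number exceeds this bound, some nonempty vertex
    set [U] is such that every vertex of [U] shares a hyperedge with at
    least [k + N - 1] other vertices of [U]. Take a longest Berge path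
    [v_0 e_0 v_1 ... e_(m-1) v_m] with all [v_i] in [U], and suppose [m < k].
    Let [Z] ([pivots] below) be the set of the [i < m] for which some
    hyperedge [f], either [e_i] itself or not on the path, contains both
    [v_i] and [v_m]; reversing the part of the path after [v_i] then gives a
    longest path with end [v_(i+1)]. Every neighbour of [v_m] lies in
    [e_i :\ v_m] or equals [v_i] for some [i] in [Z], so
    [k + N - 1 <= (r - 1) |Z|]. On the other hand, each of the new
    ends has at least [N] neighbours off the path, which are all reached
    through hyperedges of the original path. As a hyperedge with
    [a] vertices on and [b] vertices off the path satisfies [a b <= c], double
    counting gives [N |Z| <= c m], hence [(r - 1) |Z| <= m < k], a
    contradiction. *)

Set Implicit Arguments.
Unset Strict Implicit.
Unset Printing Implicit Defensive.

Lemma leq_card_bigcup (I T : finType) (Q : pred I) (F : I -> {set T}) :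
  #|\bigcup_(i | Q i) F i| <= \sum_(i | Q i) #|F i|.
Proof.
elim/big_rec2: _ => [|i n X _ leX]; first by rewrite cards0.
by rewrite (leq_trans (leq_card_setU _ _)) // leq_add2l.
Qed.

Lemma leq_mul_card_setID (T : finType) (A B : {set T}) :
  #|A :&: B| * #|A :\: B| <= #|A| ^ 2 %/ 4.
Proof. by rewrite leq_divRL // mulnC -(cardsID B A) (nat_AGM2 _ _).1. Qed.

Lemma leq_sum_card_incident_setD (I T : finType) (F : I -> {set T})
    (X P : {set T}) (r : nat) :
  X \subset P -> (forall j, #|F j| <= r) ->
  \sum_(x in X) \sum_(j | x \in F j) #|F j :\: P| <= #|I| * (r ^ 2 %/ 4).
Proof.
move=> /subsetP XP leF; rewrite (exchange_big_dep predT) //= -sum_nat_const.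
apply: leq_sum => j _; rewrite sum_nat_const.
apply: leq_trans (_ : #|F j| ^ 2 %/ 4 <= _); last first.
  by rewrite leq_div2r // leq_sqr.
apply: leq_trans (leq_mul_card_setID (F j) P); rewrite leq_mul2r.
apply/orP; right; apply/subset_leq_card/subsetP=> x /andP[/XP xP xF].
by rewrite inE xF.
Qed.

Section InitialSegment.

Variables (T : finType) (n : nat) (f : nat -> T).

Definition first_values := [set f i | i : 'I_n].

Lemma first_valuesP y :
  reflect (exists2 i, i < n & y = f i) (y \in first_values).
Proof.
apply: (iffP imsetP) => [[i _ ->]|[i lt_in ->]]; first by exists i.
by exists (Ordinal lt_in).
Qed.

Lemma mem_first_values i : i < n -> f i \in first_values.
Proof. by move=> lt_in; apply/first_valuesP; exists i. Qed.

Lemma card_first_values : #|first_values| <= n.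
Proof. by rewrite -[leqRHS]card_ord leq_imset_card. Qed.

Definition injective_below := forall i j, i < n -> j < n -> f i = f j -> i = j.

End InitialSegment.

Section Update.

Variables (T : finType) (f : nat -> T) (a : T).

Lemma eta_with_injective_below n i :
  (forall j l, j < n -> l < n -> j != i -> l != i -> f j = f l -> j = l) ->
  (forall j, j < n -> j != i -> f j != a) ->
  injective_below n [eta f with i |-> a].
Proof.
move=> f_inj neq_a j l lt_jn lt_ln /=.
case: eqVneq => [->|nj]; case: eqVneq => [->|nl] //.
- by move/esym/eqP; rewrite (negPf (neq_a l lt_ln nl)).
- by move/eqP; rewrite (negPf (neq_a j lt_jn nj)).
- exact: f_inj.
Qed.

Lemma injective_below_rcons n :
  injective_below n f -> a \notin first_values n f ->
  injective_below n.+1 [eta f with n |-> a].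
Proof.
move=> f_inj fa; have lt_n j : j < n.+1 -> j != n -> j < n by lia.
apply: eta_with_injective_below => [j l lt_j lt_l nj nl|j lt_j nj].
  by apply: f_inj; apply: lt_n.
by apply: contraNneq fa => <-; apply/mem_first_values/lt_n.
Qed.

Lemma injective_below_update n i :
  injective_below n f -> i < n -> a \notin first_values n f :\ f i ->
  injective_below n [eta f with i |-> a].
Proof.
move=> f_inj lt_i fa.
apply: eta_with_injective_below => [j l lt_j lt_l _ _|j lt_j ne_ji].
  exact: f_inj.
apply: contraNneq fa => <-; rewrite in_setD1 mem_first_values // andbT.
by apply: contraNneq ne_ji => /f_inj->.
Qed.

End Update.

Section DegenerateColoring.

Variables (T : finType) (adj : rel T).
Implicit Types (U W : {set T}) (x y : T).

Definition neighbours W x := [set y in W | (y != x) && adj x y].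

Lemma degenerate_coloring (q : nat) U :
  symmetric adj -> 0 < q ->
  (forall W, W \subset U -> W != set0 ->
     exists2 x, x \in W & #|neighbours W x| < q) ->
  exists c : {ffun T -> 'I_q},
    {in U &, forall x y, x != y -> adj x y -> c x != c y}.
Proof.
move=> adj_sym q_gt0.
have [n] := ubnP #|U|; elim: n U => // n IHn U leUn degU.
have [->|/(degU U (subxx U))[x xU ltx]] := eqVneq U set0.
  by exists [ffun=> Ordinal q_gt0] => x y; rewrite inE.
have [||c cP] := IHn (U :\ x).
- by move: leUn; rewrite (cardsD1 x) xU.
- by move=> W /subset_trans/(_ (subD1set U x)); apply: degU.
have /properP[_ [a _ a_unused]] : c @: neighbours U x \proper [set: 'I_q].
  rewrite properEcard subsetT cardsT card_ord.
  exact: leq_ltn_trans (leq_imset_card _ _) ltx.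
have aP y : y \in U -> y != x -> adj x y -> a != c y.
  move=> yU yx xy; apply: contraNneq a_unused => ->.
  by apply: imset_f; rewrite inE yU yx.
exists [ffun y => if y == x then a else c y] => y z yU zU.
rewrite !ffunE; have [->|yx] := eqVneq y x.
  by rewrite eq_sym => zx; rewrite (negPf zx); apply: aP.
have [->|zx] := eqVneq z x.
  by move=> _; rewrite adj_sym eq_sym; apply: aP.
by apply: cP; rewrite !inE ?yx ?zx.
Qed.

End DegenerateColoring.

Section StrongColoring.

Variables (T : finType) (H : hypergraph T).

Definition coadjacent x y := [exists e in H, (x \in e) && (y \in e)].

Lemma coadjacent_sym : symmetric coadjacent.
Proof.
by move=> x y; apply: eq_existsb => e; rewrite [(x \in e) && _]andbC.
Qed.

Lemma strong_colorable_degenerate (q : nat) :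
  0 < q ->
  (forall W : {set T}, W != set0 ->
     exists2 x, x \in W & #|neighbours coadjacent W x| < q) ->
  strong_colorable H q.
Proof.
move=> q_gt0 degH.
have [W _|c cP] := degenerate_coloring (U := [set: T]) coadjacent_sym q_gt0.
  exact: degH.
apply/existsP; exists c; apply/forall_inP=> e eH.
apply/dinjectiveP=> x y xe ye; apply: contra_eq => xy.
by apply: cP; rewrite ?inE //; apply/exists_inP; exists e; rewrite ?xe.
Qed.

Lemma strong_chromatic_number_core (q : nat) :
  0 < q < strong_chromatic_number H ->
  exists2 U : {set T}, U != set0
    & {in U, forall x, q <= #|neighbours coadjacent U x|}.
Proof.
case/andP=> q_gt0; rewrite /strong_chromatic_number.
case: ex_minnP => chi _ chi_min lt_q.
have [/existsP[U /andP[U0 /forall_inP]]|no_core] :=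
  boolP [exists U : {set T}, (U != set0)
          && [forall x in U, q <= #|neighbours coadjacent U x|]].
  by exists U.
suff: strong_colorable H q by move/chi_min; rewrite leqNgt lt_q.
apply: strong_colorable_degenerate => // W W0.
move: no_core; rewrite negb_exists => /forallP/(_ W).
by rewrite W0 negb_forall_in => /exists_inP[x xW]; rewrite -ltnNge; exists x.
Qed.

End StrongColoring.

Definition degree_excess (r : nat) := r.-1 * (r ^ 2 %/ 4).

Lemma degree_excess_gt0 r : 1 < r -> 0 < degree_excess r.
Proof.
by move=> r_gt1; rewrite muln_gt0 divn_gt0 // (@leq_sqr 2) r_gt1; lia.
Qed.

Section BergePaths.

Variables (T : finType) (H : hypergraph T) (U : {set T}).
Implicit Types (v : nat -> T) (e : nat -> {set T}) (f g : {set T}).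

(* Only [v 0, ..., v m] and [e 0, ..., e m.-1] matter. *)
Record berge_path (m : nat) v e : Prop := BergePath {
  berge_path_vertex : forall i, i <= m -> v i \in U;
  berge_path_edge : forall i, i < m -> e i \in H;
  berge_path_incident :
    forall i, i < m -> (v i \in e i) /\ (v i.+1 \in e i);
  berge_path_vertex_inj : injective_below m.+1 v;
  berge_path_edge_inj : injective_below m e
}.

Lemma berge_path_has_copy k v e :
  berge_path k v e -> has_berge_copy (path_graph k) H.
Proof.
case=> _ eH ve v_inj e_inj.
pose phi := [ffun i : 'I_k.+1 => v i].
(* An edge of the path graph is recovered from the sum of its two ends. *)
pose f := [ffun d : {set 'I_k.+1} => e (\sum_(i in d) i)./2].
have fE (i : 'I_k) : f [set widen_ord (leqnSn k) i; lift ord0 i] = e i.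
  rewrite ffunE big_setU1 ?big_set1 /=; first by congr e; rewrite /bump; lia.
  by rewrite inE -val_eqE /= /bump; lia.
apply/existsP; exists (f @: path_graph k); apply/andP; split.
  by apply/subsetP=> _ /imsetP[_ /imsetP[i _ ->] ->]; rewrite fE eH.
apply/existsP; exists phi; apply/existsP; exists f; apply/and4P; split=> //.
- apply/injectiveP=> i j; rewrite !ffunE.
  by move/(v_inj _ _ (ltn_ord i) (ltn_ord j))/val_inj.
- apply/dinjectiveP=> _ _ /imsetP[i _ ->] /imsetP[j _ ->].
  by rewrite !fE => /(e_inj _ _ (ltn_ord i) (ltn_ord j))/val_inj->.
- apply/forall_inP=> _ /imsetP[i _ ->]; rewrite fE.
  have [vi vSi] := ve i (ltn_ord i).
  apply/subsetP=> _ /imsetP[j ij ->]; rewrite ffunE.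
  by move: ij; rewrite !inE => /orP[] /eqP->.
Qed.

Lemma berge_path_rcons m v e f w :
  berge_path m v e -> f \in H -> f \notin first_values m e ->
  v m \in f -> w \in f -> w \in U -> w \notin first_values m.+1 v ->
  berge_path m.+1 [eta v with m.+1 |-> w] [eta e with m |-> f].
Proof.
case=> vU eH ve v_inj e_inj fH fe vf wf wU wv.
split=> [i|i|i||] /=.
- by rewrite leq_eqVlt; case: eqP => // _ /vU.
- by rewrite ltnS leq_eqVlt; case: eqP => // _ /eH.
- rewrite eqSS => lt_im; have [->|ne_im] := eqVneq i m.
    by rewrite ltn_eqF.
  by rewrite ltn_eqF; [apply: ve; lia | lia].
- exact: injective_below_rcons.
- exact: injective_below_rcons.
Qed.

Definition reverse_tail (i m j : nat) := if i < j then (m + i).+1 - j else j.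

Lemma reverse_tail_leq i m j : j <= m -> reverse_tail i m j <= m.
Proof. by rewrite /reverse_tail; case: ifP; lia. Qed.

Lemma reverse_tail_ltn i m j : j < m -> reverse_tail i m.-1 j < m.
Proof. by case: m => [|m] //; rewrite !ltnS; apply: reverse_tail_leq. Qed.

Lemma reverse_tailK i m j :
  j <= m -> reverse_tail i m (reverse_tail i m j) = j.
Proof. by rewrite /reverse_tail; case: ifP; case: ifP; lia. Qed.

Lemma injective_below_reverse_tail (A : finType) i m (h : nat -> A) :
  injective_below m.+1 h -> injective_below m.+1 (h \o reverse_tail i m).
Proof.
move=> h_inj j l le_jm le_lm eq_h.
rewrite -(@reverse_tailK i m j) // -(@reverse_tailK i m l) //.
by congr reverse_tail; apply: h_inj eq_h; apply: reverse_tail_leq.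
Qed.

Lemma berge_path_rotate m v e i f :
  berge_path m v e -> i < m -> f \in H -> v i \in f -> v m \in f ->
  f \notin first_values m e :\ e i ->
  berge_path m (v \o reverse_tail i m)
    ([eta e with i |-> f] \o reverse_tail i m.-1).
Proof.
case: m => // m [vU eH ve v_inj e_inj] lt_im fH vif vmf fe.
set e' := [eta e with i |-> f].
have e'H j : j < m.+1 -> e' j \in H.
  by move=> lt_jm; rewrite /e' /=; case: eqP => // _; apply: eH.
have e'_inj : injective_below m.+1 e' by apply: injective_below_update.
split=> [j le_jm|j lt_jm|j lt_jm||] /=.
- exact/vU/reverse_tail_leq.
- exact/e'H/reverse_tail_leq.
- rewrite /reverse_tail /e' /=; have [lt_ij|lt_ji|<-] := ltngtP i j.
  + have [lt_lm ne_li] : (m + i).+1 - j < m.+1 /\ (m + i).+1 - j != i by lia.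
    rewrite (negPf ne_li) ltnW //.
    have -> : (m.+1 + i).+1 - j.+1 = (m + i).+1 - j by lia.
    have -> : (m.+1 + i).+1 - j = ((m + i).+1 - j).+1 by lia.
    by have [] := ve _ lt_lm.
  + by rewrite ltn_eqF // ltnNge lt_ji; apply: ve.
  + rewrite eqxx ltnSn; split=> //.
    by have -> : (m.+1 + i).+1 - i.+1 = m.+1 by lia.
- exact: injective_below_reverse_tail.
- exact: injective_below_reverse_tail.
Qed.

Definition no_berge_path m := forall v e, ~ berge_path m v e.

Lemma edge_leaving_last_in_path m v e f w :
  berge_path m v e -> no_berge_path m.+1 ->
  f \in H -> v m \in f -> w \in f -> w \in U -> w \notin first_values m.+1 v ->
  f \in first_values m e.
Proof.
move=> path_ve no_path fH vf wf wU wv; apply: contraT => fe.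
by case: (no_path _ _ (berge_path_rcons path_ve fH fe vf wf wU wv)).
Qed.

Definition pivots m v e :=
  [set i : 'I_m | [exists f in H,
    [&& v i \in f, v m \in f & f \notin first_values m e :\ e i]]].

Definition rotation_ends m v e := [set v i.+1 | i : 'I_m in pivots m v e].

Section LongestPath.

Variables (r k m : nat) (v : nat -> T) (e : nat -> {set T}).
Hypothesis r_gt1 : 1 < r.
Hypothesis card_edge : {in H, forall f, #|f| <= r}.
Hypothesis degU : {in U, forall x,
  k + degree_excess r <= #|neighbours (coadjacent H) U x|.+1}.
Hypothesis path_ve : berge_path m v e.
Hypothesis no_path : no_berge_path m.+1.

Let P := first_values m.+1 v.
Let nbr := neighbours (coadjacent H) U.

Lemma neighbours_last_sub :
  nbr (v m) \subset
    \bigcup_(i in pivots m v e) if v m \in e i then e i :\ v m else [set v i].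
Proof.
have ve := berge_path_incident path_ve.
apply/subsetP=> y; rewrite inE => /and3P[yU yvm].
case/exists_inP=> f fH /andP[vmf yf].
have [/first_valuesP[i lt_im def_f]|fe] := boolP (f \in first_values m e).
  rewrite {}def_f in fH vmf yf; have [vi _] := ve i lt_im.
  apply/bigcupP; exists (Ordinal lt_im); last by rewrite /= vmf !inE yvm.
  by rewrite inE; apply/exists_inP; exists (e i); rewrite ?vi ?vmf ?setD11.
have /first_valuesP[i] : y \in P.
  by apply: contraNT fe; apply: edge_leaving_last_in_path vmf yf yU.
rewrite ltnS leq_eqVlt => /predU1P[->|lt_im] def_y.
  by rewrite def_y eqxx in yvm.
apply/bigcupP; exists (Ordinal lt_im).
  rewrite inE; apply/exists_inP; exists f => //.
  by rewrite -def_y yf vmf in_setD1 negb_and fe orbT.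
rewrite /= -def_y; case: ifP => _; last by rewrite inE.
by rewrite !inE yvm def_y; case: (ve i lt_im).
Qed.

Lemma card_neighbours_last : #|nbr (v m)| <= r.-1 * #|pivots m v e|.
Proof.
have eH := berge_path_edge path_ve.
apply: leq_trans (subset_leq_card neighbours_last_sub) _.
apply: leq_trans (leq_card_bigcup _ _) _.
rewrite mulnC -sum_nat_const; apply: leq_sum => i _; case: ifP => [vmi|_].
  by have := card_edge (eH i (ltn_ord i)); rewrite (cardsD1 (v m)) vmi; lia.
by rewrite cards1; lia.
Qed.

Lemma edge_leaving_rotation_end_in_path x g w :
  x \in rotation_ends m v e -> g \in H -> x \in g -> w \in g -> w \in U ->
  w \notin P -> g \in first_values m e.
Proof.
case/imsetP=> i; rewrite inE => /exists_inP[f fH /and3P[vif vmf fe]] ->.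
move=> gH vSg wg wU wP.
have rpath := berge_path_rotate path_ve (ltn_ord i) fH vif vmf fe.
have w_off : w \notin first_values m.+1 (v \o reverse_tail i m).
  apply: contra wP => /first_valuesP[j lt_jm ->].
  exact/mem_first_values/reverse_tail_leq.
have vgm : (v \o reverse_tail i m) m \in g.
  by rewrite /= /reverse_tail ltn_ord -addnS addKn.
have /first_valuesP[j lt_jm /=] :=
  edge_leaving_last_in_path rpath no_path gH vgm wg wU w_off.
case: eqP => [_ def_g|_ ->].
  rewrite def_g in wg *.
  exact: edge_leaving_last_in_path path_ve no_path fH vmf wg wU wP.
exact/mem_first_values/reverse_tail_ltn.
Qed.

Lemma card_rotation_ends : #|rotation_ends m v e| = #|pivots m v e|.
Proof.
have v_inj := berge_path_vertex_inj path_ve.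
rewrite card_in_imset // => i j _ _.
by case/(v_inj i.+1 j.+1 (ltn_ord i) (ltn_ord j))=> /val_inj.
Qed.

Lemma rotation_ends_sub : rotation_ends m v e \subset P.
Proof.
by apply/subsetP=> _ /imsetP[i _ ->]; apply: mem_first_values; rewrite ltnS.
Qed.

Lemma card_neighbours_off_path x :
  m < k -> x \in P -> degree_excess r <= #|nbr x :\: P|.
Proof.
move=> lt_mk xP.
have xU : x \in U.
  by have /first_valuesP[i le_im ->] := xP; exact: (berge_path_vertex path_ve).
suff: #|nbr x :&: P| <= m by have := degU xU; rewrite -/nbr -(cardsID P); lia.
have: #|P| <= m.+1 := card_first_values _ _.
rewrite (cardsD1 x) xP ltnS; apply: leq_trans.
apply/subset_leq_card/subsetP=> y; rewrite !inE.
by case/andP=> /and3P[_ -> _].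
Qed.

Lemma off_path_neighbours_sub x :
  x \in rotation_ends m v e ->
  nbr x :\: P \subset \bigcup_(j < m | x \in e j) (e j :\: P).
Proof.
move=> xX; apply/subsetP=> w; rewrite inE inE => /and3P[wP wU].
case/andP=> _ /exists_inP[g gH /andP[xg wg]].
have /first_valuesP[j lt_jm def_g] :=
  edge_leaving_rotation_end_in_path xX gH xg wg wU wP.
by apply/bigcupP; exists (Ordinal lt_jm); rewrite /= -def_g // inE wP.
Qed.

Lemma longest_berge_path_length : k <= m.
Proof.
rewrite leqNgt; apply/negP=> lt_mk; set c := r ^ 2 %/ 4.
have off_path x :
    x \in rotation_ends m v e ->
    degree_excess r <= \sum_(j < m | x \in e j) #|e j :\: P|.
  move=> xX; apply: leq_trans (leq_card_bigcup _ _).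
  apply: leq_trans (subset_leq_card (off_path_neighbours_sub xX)).
  exact/card_neighbours_off_path/(subsetP rotation_ends_sub).
have few_ends : #|rotation_ends m v e| * degree_excess r <= m * c.
  rewrite -[m in m * c]card_ord -sum_nat_const.
  apply: leq_trans (_ : \sum_(x in rotation_ends m v e) _ <= _).
    exact: leq_sum off_path.
  apply: (leq_sum_card_incident_setD rotation_ends_sub) => j.
  exact/card_edge/(berge_path_edge path_ve).
have many_ends : k + degree_excess r <= (r.-1 * #|rotation_ends m v e|).+1.
  have vmU := berge_path_vertex path_ve (leqnn m).
  apply: leq_trans (degU vmU) _.
  by rewrite ltnS card_rotation_ends card_neighbours_last.
have excess_gt0 := degree_excess_gt0 r_gt1.
have c_gt0 : 0 < c by move: excess_gt0; rewrite muln_gt0 => /andP[].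
by move: few_ends; rewrite mulnA leq_pmul2r // mulnC; lia.
Qed.

End LongestPath.

End BergePaths.

Lemma strong_chromatic_number_berge_path_free
    (T : finType) (H : hypergraph T) (r k : nat) :
  1 < r -> 0 < k -> {in H, forall e : {set T}, #|e| <= r} ->
  berge_free (path_graph k) H ->
  strong_chromatic_number H < k + degree_excess r.
Proof.
move=> r_gt1 k_gt0 card_edge /negP H_free; rewrite ltnNge; apply/negP=> le_chi.
have excess_gt0 := degree_excess_gt0 r_gt1.
have [|U /set0Pn[x xU] degU] :=
  @strong_chromatic_number_core _ H (k + degree_excess r).-1; first by lia.
have {}degU : {in U, forall x,
    k + degree_excess r <= #|neighbours (coadjacent H) U x|.+1}.
  by move=> y /degU; lia.
suff no_path m : m <= k -> ~ no_berge_path H U m.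
  by apply: (no_path k) => // v e /berge_path_has_copy.
elim: m => [_|m IHm lt_mk] no_path.
  by apply: (no_path (fun=> x) (fun=> set0)); split=> // i j; lia.
apply: IHm => [|v e path_ve]; first exact: ltnW.
by have := longest_berge_path_length r_gt1 card_edge degU path_ve no_path; lia.
Qed.

Theorem theorem1p8 (k n : nat) (hk : 0 < k) :
  (forall (T : finType) (H : hypergraph T),
      #|T| = n -> uniform 4 H -> berge_free (path_graph k) H ->
      strong_chromatic_number H <= k + 11)
  /\ schex 4 n (path_graph k) <= k + 11.
Proof.
have bound (T : finType) (H : hypergraph T) :
    uniform 4 H -> berge_free (path_graph k) H ->
    strong_chromatic_number H <= k + 11.
  move=> /forall_inP H4 H_free; rewrite -ltnS -addnS.
  apply: (@strong_chromatic_number_berge_path_free _ _ 4) => // e /H4/eqP->.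
  exact: leqnn.
split=> [T H _|]; first exact: bound.
by apply/bigmax_leqP=> H /andP[]; apply: bound.
Qed.
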